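(* Assume that $\mathfrak{b}=\mathfrak{c}$. For each natural number $k\ge 1$, there is a set of real numbers (a subspace of $\mathbb{R}$) that is $\mathsf{U}_{k+1}(\Gamma,\Gamma)$ but not $\mathsf{U}_k(\Gamma,\Gamma)$.
   Context: $\mathbb{N}=\{1,2,\dots\}$. For $a,b\in\mathbb{N}^{\mathbb{N}}$, $a\le^* b$ means $a(n)\le b(n)$ for all but finitely many $n$. $\mathfrak{b}$ is the minimal cardinality of a subset of $\mathbb{N}^{\mathbb{N}}$ with no $\le^*$-upper bound in $\mathbb{N}^{\mathbb{N}}$, and $\mathfrak{c}=2^{\aleph_0}$. Spaces are infinite Hausdorff. A cover of a space $X$ is a family $\mathcal{U}$ of subsets of $X$ with $X=\bigcup\mathcal{U}$ and $X\notin\mathcal{U}$. $\Gamma(X)$ is the family of infinite open covers $\mathcal{U}$ of $X$ such that each $x\in X$ belongs to all but finitely many members of $\mathcal{U}$. For a natural number $k$, a space $X$ is $\mathsf{U}_k(\Gamma,\Gamma)$ if for all $\mathcal{U}_1,\mathcal{U}_2,\dots\in\Gamma(X)$, none having a finite subcover, there are $\mathcal{F}_n\subseteq\mathcal{U}_n$ with $|\mathcal{F}_n|\le k$ for all $n$ and $\{\bigcup\mathcal{F}_n:n\in\mathbb{N}\}\in\Gamma(X)$. *)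

(* Defs.v *)
From HB Require Import structures.
From mathcomp Require Import all_boot all_order all_algebra.
From mathcomp Require Import all_classical all_reals all_analysis.

Set Implicit Arguments.
Unset Strict Implicit.
Unset Printing Implicit Defensive.

Import numFieldNormedType.Exports.

Local Open Scope classical_set_scope.
Local Open Scope card_scope.

Definition le_star (a b : nat -> nat) : Prop :=
  finite_set [set n | ~ (a n <= b n)%N].

Definition le_star_unbounded (F : set (nat -> nat)) : Prop :=
  ~ exists b, forall a, F a -> le_star a b.

(* [has_card_b A] means |A| = b: the cardinality of A is attained by an
   unbounded family and is the least one attained. *)
Definition has_card_b (T : Type) (A : set T) : Prop :=
  (exists2 F, le_star_unbounded F & A #= F) /\
  (forall F, le_star_unbounded F -> A #<= F).

(* c = 2^aleph_0 is the cardinality of the power set of nat. *)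
Definition b_eq_c : Prop := has_card_b [set: set nat].

(* The whole space is not allowed to be a member of a cover. *)
Definition is_cover (X : Type) (U : set (set X)) : Prop :=
  \bigcup_(V in U) V = setT /\ ~ U setT.

Definition Gamma (X : topologicalType) : set (set (set X)) :=
  [set U | [/\ is_cover U, infinite_set U, (forall V, U V -> open V) &
              forall x : X, finite_set [set V | U V /\ ~ V x]]].

Definition has_finite_subcover (X : Type) (U : set (set X)) : Prop :=
  exists F, [/\ F `<=` U, finite_set F & is_cover F].

Definition U_Gamma_Gamma (k : nat) (X : topologicalType) : Prop :=
  forall U : nat -> set (set X),
    (forall n, Gamma (U n)) ->
    (forall n, ~ has_finite_subcover (U n)) ->
    exists F : nat -> set (set X),
      (forall n, F n `<=` U n /\ F n #<= `I_k) /\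
      Gamma (range (fun n => \bigcup_(V in F n) V)).

(* Main.v *)
Require Import Defs.
From HB Require Import structures.
From mathcomp Require Import all_boot all_order all_algebra.
From mathcomp Require Import all_classical all_reals all_analysis.
From mathcomp Require Import wochoice zify lra.
Import numFieldNormedType.Exports.
Local Open Scope classical_set_scope.

(** The space X is a copy in the real line of a family of sets of natural numbers,
    with the topology of the Cantor space. It consists of all finite sets and of
    sparse sets [x t], one for each [t] in an index set of size the continuum. A set is
    [k]-sparse for a function [f] if it has at most [k] elements in the interval
    [p, f p) for all large [p].

    Since b = c, the index set can be ordered so that the functions named by the
    predecessors of [t] have a common eventual bound ([small_segments]). Then [x t]
    can be chosen [k]-sparse for all of these functions, and it can contain infinitely
    many prescribed blocks of at most [k] elements, provided that the blocks used are
    far apart ([sparse_diagonal], [sparse_family]).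

    Sparsity gives the positive property for [k.+1] ([sparse_U_Gamma_Gamma]). A
    member of a point-cofinite cover that contains all finite subsets of [0, a) contains, by
    openness, every set of the space that has no element in some interval [a, a').
    Iterating, each cover has members attached to consecutive intervals, and a set
    with at most [k] elements in [k.+1] of these intervals misses one of them, hence lies in
    the union of the [k.+1] corresponding members. The sets that are not sparse enough
    are indexed by an initial segment, so by b = c the stages from which the members
    contain them have a common eventual bound, and members beyond it are taken.

    For the failure at [k], the cover at stage [n] consists for [n < m] of the sets of points
    that do not have [m] among their first [k] elements from [n] on (with a twist at
    points containing 0, which rules out finite subcovers). Selecting at most [k]
    members at stage [n] means to choose a block of at most [k] numbers, and a point
    whose first elements from [n] on are exactly this block is not covered. The sets
    [x t] do this for every possible selection ([not_U_Gamma_Gamma]). *)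

Set Implicit Arguments.
Unset Strict Implicit.
Unset Printing Implicit Defensive.

Lemma finite_natP (A : set nat) :
  finite_set A <-> exists N, forall m, A m -> (m < N)%N.
Proof.
split=> [/finite_seqP[s ->]|[N AN]]; last first.
  by apply: (sub_finite_set _ (finite_II N)) => m /AN.
exists (\max_(i <- s) i).+1 => m /= ms; rewrite ltnS.
exact: leq_bigmax_seq.
Qed.

Lemma infinite_natP (A : set nat) :
  infinite_set A <-> forall N, exists2 n, (N <= n)%N & A n.
Proof.
split=> [infA N|unbA /finite_natP[N AN]]; last first.
  by have [n Nn /AN] := unbA N; rewrite ltnNge Nn.
apply: contrapT => noA; apply: infA; apply/finite_natP; exists N => m Am.
by rewrite ltnNge; apply/negP => Nm; apply: noA; exists m.
Qed.

Lemma cofiniteP (P : set nat) :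
  finite_set [set n | ~ P n] <-> exists N, forall n, (N <= n)%N -> P n.
Proof.
split=> [/finite_natP[N HN]|[N HN]].
  exists N => n Nn; apply: contrapT => /HN; lia.
apply/finite_natP; exists N => m /= Pm; rewrite ltnNge; apply/negP => /HN.
exact: Pm.
Qed.

Lemma le_starP (a b : nat -> nat) :
  le_star a b <-> exists N, forall n, (N <= n)%N -> (a n <= b n)%N.
Proof. exact: cofiniteP. Qed.

(** An infinite index set mapped into a finite set has an infinite fibre. *)
Lemma finite_fibres (T : Type) (J : set nat) (W : nat -> T) (V : set T) :
  finite_set V -> (forall n, J n -> V (W n)) ->
  (forall n0, J n0 -> finite_set [set n | J n /\ W n = W n0]) ->
  finite_set J.
Proof.
move=> finV JV fib.
apply: (@sub_finite_set _ _ (\bigcup_(v in V) [set n | J n /\ W n = v])).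
  by move=> n Jn; exists (W n); [exact: JV|].
apply: bigcup_finite => // v _.
have [[n0 [Jn0 <-]]|no] := pselect (exists n, J n /\ W n = v); first exact: fib.
by apply: (sub_finite_set _ (@finite_set0 nat)) => n Jn; apply: no; exists n.
Qed.

Lemma card_le_inj (T U : Type) (A : set T) (B : set U) (f : T -> U) :
  (forall x, A x -> B (f x)) ->
  (forall x y, A x -> A y -> f x = f y -> x = y) -> (A #<= B)%card.
Proof.
move=> AB finj; have fAB : f @` A `<=` B by move=> _ [x Ax <-]; exact: AB.
apply: (card_le_trans _ (subset_card_le fAB)).
have /card_eqPle[_ //] : (f @` A #= A)%card.
by apply: inj_card_eq => x y; rewrite !inE; exact: finj.
Qed.

(** * A scale of length the continuum *)

(** Under b = c the power set of nat has a total preorder all of whose initial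
    segments index bounded families. A well-order is cut down to a length at
    which no initial segment has the size of the continuum; every family indexed
    by an initial segment is then too small to be unbounded. *)
Lemma small_segments (hbc : b_eq_c) :
  exists L : set nat -> set nat -> Prop, (forall s t, L s t \/ L t s) /\
    forall t (g : set nat -> nat -> nat), exists b,
      forall s, L s t -> le_star (g s) b.
Proof.
have [W Wwo] := well_ordering_principle (set nat).
have Wtot s t : W s t \/ W t s.
  have [|z [[]]] := Wwo (pred2 s t); first by exists s; rewrite inE eqxx.
  rewrite inE => /orP[] /eqP-> Wz _.
    by left; apply: Wz; rewrite inE eqxx orbT.
  by right; apply: Wz; rewrite inE eqxx.
have Wanti s t : W s t -> W t s -> s = t.
  move=> st ts.
  have [|z [_ zuniq]] := Wwo (pred2 s t); first by exists s; rewrite inE eqxx.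
  have Wrefl u : W u u by case: (Wtot u u).
  have <- : z = s.
    apply: zuniq; split; first by rewrite inE eqxx.
    by move=> u; rewrite inE => /orP[] /eqP->.
  apply: zuniq; split; first by rewrite inE eqxx orbT.
  by move=> u; rewrite inE => /orP[] /eqP->.
pose seg t := [set u | W u t /\ u <> t].
have [i [iinj ismall]] : exists i : set nat -> set nat, injective i /\
    forall t, ~ ([set: set nat] #<= seg (i t))%card.
  have [[t0 t0big]|nobig] :=
    pselect (exists t, ([set: set nat] #<= seg t)%card); last first.
    by exists id; split=> // t tbig; apply: nobig; exists t.
  pose big := [pred t | `[< ([set: set nat] #<= seg t)%card >]].
  have [|z [[/asboolP zbig zmin] _]] := Wwo big.
    by exists t0; exact/asboolP.
  have /pcard_leP[i] := zbig.
  exists i; split=> [s t /(@inj _ _ _ i)|t tbig].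
    by apply; rewrite inE.
  have [itz] := @funS _ _ _ _ i t I; apply; apply: Wanti => //.
  by apply: zmin; exact/asboolP.
exists (fun s t => W (i s) (i t)); split=> [s t|t g]; first exact: Wtot.
pose D := [set s | seg (i t) (i s)].
have Dle : (D #<= seg (i t))%card.
  by apply: (@card_le_inj _ _ _ _ i) => // s s' _ _; exact: iinj.
have [b bD] : exists b, forall a, (g @` D) a -> le_star a b.
  apply: contrapT => unb; apply: (ismall t).
  apply: card_le_trans (hbc.2 _ unb) _.
  exact: card_le_trans (card_image_le _ _) Dle.
exists (fun n => maxn (b n) (g t n)) => s st; apply/le_starP.
have [->|sNt] := pselect (s = t); first by exists 0%N => n _; rewrite leq_maxr.
have /le_starP[N HN] : le_star (g s) b.
  by apply: bD; exists s => //; split => // /iinj.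
by exists N => n /HN Hn; rewrite leq_max Hn.
Qed.

(** * Spaces of sets of natural numbers *)

(** The map [r] makes [S] a subspace of the Cantor space of sets of natural
    numbers: basic neighbourhoods prescribe a finite part of [r w]. *)
Definition cantor_induced (S : topologicalType) (r : S -> set nat) :=
  forall V : set S, open V <-> forall w, V w -> exists a,
    forall w', (forall i, (i < a)%N -> (r w i <-> r w' i)) -> V w'.

Definition sparse (k : nat) (f : nat -> nat) (x : set nat) :=
  exists N, forall p, (N <= p)%N ->
    ([set i | x i /\ (p <= i < f p)%N] #<= `I_k)%card.

Lemma finite_sparse k f x : finite_set x -> sparse k f x.
Proof.
move=> /finite_natP[N xN]; exists N => p Np.
apply: (@card_le_inj _ _ _ _ id) => // i [/xN]; lia.
Qed.

Lemma Gamma_range (S : topologicalType) (W : nat -> set S) :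
  (forall n, open (W n)) -> (forall n, W n <> setT) ->
  (forall w, exists N, forall n, (N <= n)%N -> W n w) -> Gamma (range W).
Proof.
move=> Wopen WT Wev; split; first split.
- apply/seteqP; split=> // w _; have [N WN] := Wev w.
  by exists (W N); [exists N|exact: WN].
- by case=> n _ /WT.
- move=> finW; apply: infinite_nat.
  apply: (finite_fibres (J := setT) (W := W) finW) => [n _|n0 _]; first by exists n.
  have [w Ww] : exists w, ~ W n0 w.
    apply: contrapT => all; apply: (WT n0); apply/seteqP; split=> // w _.
    by apply: contrapT => nw; apply: all; exists w.
  have [N WN] := Wev w; apply/finite_natP; exists N => m [_ WmE].
  by rewrite ltnNge; apply/negP => /WN; rewrite WmE.
- by move=> _ [n _ <-].
- move=> w; have [N WN] := Wev w.
  apply: (@sub_finite_set _ _ (W @` `I_N)); last exact/finite_image/finite_II.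
  move=> _ [[n _ <-] Wnw]; exists n => //=.
  by rewrite ltnNge; apply/negP => /WN.
Qed.

Lemma Gamma_enum (X : topologicalType) (U : set (set X)) : Gamma U ->
  exists u : nat -> set X, (forall m, U (u m)) /\
    forall w, exists N, forall m, (N <= m)%N -> u m w.
Proof.
move=> [_ /infiniteP/pcard_leP[u] _ Upf]; exists u; split=> [m|w].
  exact: (@funS _ _ _ _ u m I).
apply/cofiniteP.
apply: (@sub_finite_set _ _ (u @^-1` [set V | U V /\ ~ V w])).
  by move=> m /= uw; split=> //; exact: (@funS _ _ _ _ u m I).
apply: finite_preimage (Upf w) => m m' _ _.
by apply: (@inj _ _ _ u); rewrite inE.
Qed.

(** * Sparse sets and selection from covers *)

Section Selection.
Variables (S : topologicalType) (r : S -> set nat).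
Hypothesis rS : cantor_induced r.
Hypothesis rfin : forall q, finite_set q -> exists w, r w = q.

(** The traces on [0, t) of the points of [S] are finitely many finite sets, so
    some late member of the cover contains all of these finite sets; as it is open, it
    contains each point whose next element beyond its trace comes late. *)
Lemma cover_gap (u : nat -> set S) (t j : nat) : (forall m, open (u m)) ->
  (forall w, exists N, forall m, (N <= m)%N -> u m w) ->
  exists m a, [/\ (j <= m)%N, (t < a)%N &
    forall w, (forall i, (t <= i < a)%N -> ~ r w i) -> u m w].
Proof.
move=> uo uev.
pose qs (q : {set 'I_t}) := [set i : nat | exists2 l : 'I_t, l \in q & val l = i].
have /choice[w_ w_q] : forall q, exists w, r w = qs q.
  move=> q; apply: rfin; apply/finite_natP; exists t => _ [l _ <-].
  exact: ltn_ord.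
have /choice[N_ N_q] : forall q, exists N, forall m, (N <= m)%N -> u m (w_ q).
  by move=> q; exact: uev.
pose m := maxn j (\max_q N_ q).
have umq q : u m (w_ q).
  by apply: N_q; rewrite leq_max (leq_bigmax q) orbT.
have /choice[a_ a_q] : forall q, exists a,
    forall w', (forall i, (i < a)%N -> (r (w_ q) i <-> r w' i)) -> u m w'.
  by move=> q; have /rS/(_ _ (umq q)) := uo m.
exists m, (maxn t.+1 (\max_q a_ q)); split; rewrite ?leq_max ?leqnn // => w gap.
pose q : {set 'I_t} := finset (fun l : 'I_t => `[< r w l >]).
apply: (a_q q) => i ia; rewrite w_q.
have [it|ti] := ltnP i t.
  split=> [[l]|rwi]; first by rewrite finset.inE => /asboolP + <-.
  by exists (Ordinal it) => //; rewrite finset.inE; apply/asboolP.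
split=> [[l _ li]|rwi]; first by have : (val l < t)%N := ltn_ord l; rewrite li ltnNge ti.
case: (gap i) => //; rewrite ti leq_max; apply/orP; right.
exact: leq_trans ia (leq_bigmax q).
Qed.

Lemma cover_blocks (U : set (set S)) (n : nat) : Gamma U ->
  exists (V : nat -> set S) (a : nat -> nat),
    [/\ forall i, U (V i), a 0 = n, forall i, (a i < a i.+1)%N,
        forall i w, (forall l, (a i <= l < a i.+1)%N -> ~ r w l) -> V i w &
        forall w, exists N, forall i, (N <= i)%N -> V i w].
Proof.
move=> UG; have [u [uU uev]] := Gamma_enum UG.
have uo m : open (u m) by case: UG => _ _ + _; apply.
have /choice[g gP] : forall s : nat * nat, exists s' : nat * nat,
    [/\ (s.1.+1 <= s'.1)%N, (s.2 < s'.2)%N &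
      forall w, (forall i, (s.2 <= i < s'.2)%N -> ~ r w i) -> u s'.1 w].
  by move=> [j t]; have [m [a ?]] := cover_gap t j.+1 uo uev; exists (m, a).
pose s i := iter i g (0, n).
exists (fun i => u (s i.+1).1), (fun i => (s i).2); split=> //.
- by move=> i; have [] := gP (s i).
- by move=> i w; have [_ _] := gP (s i); exact.
- move=> w; have [N uN] := uev w; exists N => i Ni; apply: uN.
  apply: leq_trans Ni _; elim: i => // i IH.
  by apply: leq_ltn_trans IH _; have [] := gP (s i.+1).
Qed.

(** The cover at stage [n] is arranged so that its [i]-th member contains every
    point missing the [i]-th of a sequence of consecutive intervals. A point with
    at most [k] elements in [k.+1] of these intervals misses one of them, so
    any [k.+1] consecutive members cover it. One function [f] bounds the lengths
    of all such runs wherever they start; hence the starting index [h n] can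
    still be chosen after [f], so large that the points not sparse for [f] are
    contained in the chosen members as well. *)
Lemma sparse_U_Gamma_Gamma (k : nat) :
  (forall f : nat -> nat, exists A : set S,
    (forall g : S -> nat -> nat, exists h, forall w, A w -> le_star (g w) h) /\
    forall w, ~ A w -> sparse k f (r w)) ->
  U_Gamma_Gamma k.+1 S.
Proof.
move=> HA U UG Unf.
have /choice[Va VaP] : forall n, exists Va : (nat -> set S) * (nat -> nat),
    [/\ forall i, U n (Va.1 i), Va.2 0 = n, forall i, (Va.2 i < Va.2 i.+1)%N,
        forall i w, (forall l, (Va.2 i <= l < Va.2 i.+1)%N -> ~ r w l) ->
          Va.1 i w &
        forall w, exists N, forall i, (N <= i)%N -> Va.1 i w].
  by move=> n; have [V [a ?]] := @cover_blocks _ n (UG n); exists (V, a).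
pose V n := (Va n).1; pose a n := (Va n).2.
have VU n i : U n (V n i) by have [+ _ _ _ _] := VaP n; exact.
have a0 n : a n 0 = n by have [] := VaP n.
have aS n i : (a n i < a n i.+1)%N by have [_ _ + _ _] := VaP n; exact.
have aV n i w : (forall l, (a n i <= l < a n i.+1)%N -> ~ r w l) -> V n i w.
  by have [_ _ _ + _] := VaP n; apply.
have amono n i i' : (i <= i')%N -> (a n i <= a n i')%N.
  elim: i' => [|i' IH]; first by rewrite leqn0 => /eqP->.
  by rewrite leq_eqVlt => /orP[/eqP->//|/IH Hi]; apply: leq_trans Hi (ltnW _).
have an n i : (n + i <= a n i)%N.
  elim: i => [|i IH]; first by rewrite a0 addn0.
  by rewrite addnS; apply: leq_ltn_trans IH (aS _ _).
pose f p := \max_(n < p.+1) \max_(i < p.+1) a n (i + k.+1).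
have fP n i : (a n (i + k.+1) <= f (a n i))%N.
  have an' := an n i.
  have Hn : (n < (a n i).+1)%N by lia.
  have Hi : (i < (a n i).+1)%N by lia.
  apply: (@leq_trans (\max_(i' < (a n i).+1) a n (i' + k.+1))).
    exact: (leq_bigmax (F := fun i' : 'I_(a n i).+1 => a n (i' + k.+1))
      (Ordinal Hi)).
  exact: (leq_bigmax (F := fun n' : 'I_(a n i).+1 =>
    \max_(i' < (a n i).+1) a n' (i' + k.+1)) (Ordinal Hn)).
have [A [Asmall Asparse]] := HA f.
have /choice[g gP] : forall w, exists g : nat -> nat,
    forall n i, (g n <= i)%N -> V n i w.
  move=> w; suff /choice[g gP] : forall n, exists N, forall i, (N <= i)%N -> V n i w.
    by exists g.
  by move=> n; have [_ _ _ _] := VaP n; exact.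
have [h hA] := Asmall g.
pose F n := [set V n (h n + i) | i in `I_k.+1].
exists F; split=> [n|].
  split; first by move=> _ [i _ <-]; exact: VU.
  exact: card_image_le.
apply: Gamma_range => [n|n FT|w].
- by apply: bigcup_open => _ [i _ <-]; case: (UG n) => _ _ + _; apply.
- apply: (Unf n); exists (F n); split.
  + by move=> _ [i _ <-]; exact: VU.
  + exact/finite_image/finite_II.
  + split=> //; case=> i _ VT; case: (UG n) => -[_ UT] _ _ _; apply: UT.
    by rewrite -VT; exact: VU.
have [Aw|nAw] := pselect (A w).
  have /le_starP[N HN] := hA _ Aw; exists N => n /HN gh.
  exists (V n (h n + 0)); first by exists 0.
  by apply: gP; rewrite addn0.
have [N HN] := Asparse _ nAw; exists N => n Nn.
apply: contrapT => nF.
have /choice[l lP] : forall i : nat, exists l, (i < k.+1)%N ->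
    (a n (h n + i) <= l < a n (h n + i).+1)%N /\ r w l.
  move=> i; have [ik|] := ltnP i k.+1; last by exists 0.
  apply: contrapT => nol; apply: nF; exists (V n (h n + i)); first by exists i.
  by apply: aV => l lP rwl; apply: nol; exists l.
have: (`I_k.+1 #<= `I_k)%card.
  have Np : (N <= a n (h n))%N by have := an n (h n); lia.
  apply: card_le_trans (HN _ Np).
  apply: (@card_le_inj _ _ _ _ l) => /= [i ik|i i' ik i'k ll'].
    have [/andP[al la] rwl] := lP i ik; split=> //; apply/andP; split.
      by apply: leq_trans al; apply: amono; lia.
    apply: leq_trans la _; apply: leq_trans (fP _ _); apply: amono; lia.
  have [/andP[al la] _] := lP i ik; have [/andP[al' la'] _] := lP i' i'k.
  have [lt|lt|//] := ltngtP i i'.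
    have := @amono n (h n + i).+1 (h n + i'); lia.
  have := @amono n (h n + i').+1 (h n + i); lia.
by rewrite card_le_II ltnn.
Qed.

(** * Covers on which selecting few members fails *)

(** Condition [x 0] makes the finite set {0} + F avoid all the sets
    indexed by F, which excludes finite subcovers; the second alternative
    applies to the points without 0, each of which is then missed by at most [k]
    of the sets, all of them indexed by its first elements beyond [n]. *)
Definition missed (k n m : nat) (x : set nat) : Prop :=
  x m /\ (x 0 \/ ([set i | x i /\ (n <= i <= m)%N] #<= `I_k)%card).

Definition block_set (k n m : nat) : set S := [set w | ~ missed k n m (r w)].

Definition block_cover (k n : nat) : set (set S) :=
  [set block_set k n m | m in [set m | (n < m)%N]].

Lemma finite_missed k n x : finite_set x \/ ~ x 0 ->
  finite_set [set m | (n < m)%N /\ missed k n m x].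
Proof.
case=> [finx|x0]; first by apply: sub_finite_set finx => m [_ []].
apply: contrapT => infB; have /infiniteP/pcard_leP[u] := infB.
have uB i : (n < u i)%N /\ missed k n (u i) x := @funS _ _ _ _ u i I.
have /finite_natP[N uN] := finite_image u (finite_II k.+1).
have [m Nm [_ [_ []//]]] := (infinite_natP _).1 infB N.
move=> few; have: (`I_k.+1 #<= `I_k)%card.
  apply: card_le_trans few; apply: (@card_le_inj _ _ _ _ u) => [i ik|i j _ _].
    have [nu [xu _]] := uB i; split=> //.
    by have := uN (u i) (ex_intro2 _ _ i ik erefl); lia.
  by apply: (@inj _ _ _ u); rewrite inE.
by rewrite card_le_II ltnn.
Qed.

Lemma missed_singleton k n q m : q 0 -> q m -> missed k n m q.
Proof. by move=> q0 qm; split=> //; left. Qed.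

Lemma exists_zero_set (q : set nat) : finite_set q ->
  exists w, r w = 0%N |` q.
Proof. by move=> finq; apply: rfin; rewrite finite_setU; split. Qed.

Lemma block_set_inj k n m m' : (n < m)%N -> (n < m')%N ->
  block_set k n m = block_set k n m' -> m = m'.
Proof.
move=> nm nm' E; have [w wq] := exists_zero_set (finite_set1 m).
have : ~ block_set k n m w.
  by apply; rewrite wq; apply: missed_singleton; [left|right].
rewrite E => /contrapT[]; rewrite wq => -[/= m'0|/= ->//].
by rewrite m'0 in nm'.
Qed.

Lemma open_block_set k n m : open (block_set k n m).
Proof.
apply/rS => w Vw; exists m.+1 => w' ww' [w'm miss]; apply: Vw; split.
  by apply/ww'.
case: miss => [w'0|miss]; first by left; apply/ww'.
right; apply: card_le_trans miss; apply: subset_card_le => i [wi nim].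
by split=> //; apply/ww' => //; lia.
Qed.

Hypothesis rpoint : forall w, finite_set (r w) \/ ~ r w 0.

Lemma Gamma_block_cover k n : Gamma (block_cover k n).
Proof.
have pf w : finite_set [set V | block_cover k n V /\ ~ V w].
  apply: sub_finite_set (finite_image (block_set k n)
    (finite_missed k n (rpoint w))).
  by move=> _ [[m nm <-] /contrapT miss]; exists m.
have inf : infinite_set (block_cover k n).
  apply/infiniteP; apply: (@card_le_inj _ _ _ _ (fun i => block_set k n (n + i).+1)).
    by move=> i _; exists (n + i).+1 => //=; lia.
  move=> i j _ _ /block_set_inj; lia.
split=> //; first split.
- apply/seteqP; split=> // w _.
  have /infinite_setD/(_ (pf w)) := inf.
  move=> infD; have [V [UV VP]] : exists V, (block_cover k n `\` [set V | block_cover k n V /\ ~ V w]) V.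
    apply: contrapT => no; apply: infD.
    by apply: (sub_finite_set _ (@finite_set0 _)) => V DV; apply: no; exists V.
  by exists V => //; apply: contrapT => nV; apply: VP.
- case=> m nm VT; have [w wq] := exists_zero_set (finite_set1 m).
  have : block_set k n m w by rewrite VT.
  by apply; rewrite wq; apply: missed_singleton; [left|right].
- by move=> _ [m _ <-]; exact: open_block_set.
Qed.

Lemma block_cover_nofin k n : ~ has_finite_subcover (block_cover k n).
Proof.
move=> [F [FU finF [Fcov _]]].
pose q := [set m | (n < m)%N /\ F (block_set k n m)].
have finq : finite_set q.
  apply: card_le_finite finF.
  apply: (@card_le_inj _ _ _ _ (block_set k n)) => [m []//|m m' [nm _] [nm' _]].
  exact: block_set_inj.
have [w wq] := exists_zero_set finq.
have : (\bigcup_(V in F) V) w by rewrite Fcov.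
case=> V FV; have [m nm VE] := FU V FV; rewrite -VE; apply; rewrite wq.
by apply: missed_singleton; [left|right; split=> //; rewrite VE].
Qed.

(** A selection of at most [k] members of each cover is a sequence of finite sets
    [M n] of indices, and the point given by the hypothesis is avoided by the selected
    unions at infinitely many stages. These unions cannot take only finitely many
    values: the point {0} + M n0 is avoided at stage [n0] but not at a stage
    beyond all elements of [M n0]. *)
Lemma not_U_Gamma_Gamma (k : nat) :
  (forall M : nat -> set nat, (forall n m, M n m -> (n < m)%N) ->
    (forall n, (M n #<= `I_k)%card) -> infinite_set [set n | M n !=set0] ->
    exists w, infinite_set [set n | M n !=set0 /\
      forall m, M n m -> missed k n m (r w)]) ->
  ~ U_Gamma_Gamma k S.
Proof.
move=> HM /(_ (block_cover k) (Gamma_block_cover k) (@block_cover_nofin k)).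
move=> [F [FP [_ Winf _ Wpf]]].
pose W n := \bigcup_(V in F n) V.
pose M n := [set m | (n < m)%N /\ F n (block_set k n m)].
have Mn n m : M n m -> (n < m)%N by case.
have Mk n : (M n #<= `I_k)%card.
  apply: card_le_trans (FP n).2.
  apply: (@card_le_inj _ _ _ _ (block_set k n)) => [m []//|m m' [nm _] [nm' _]].
  exact: block_set_inj.
have Wmissed n w : (forall m, M n m -> missed k n m (r w)) -> ~ W n w.
  move=> miss [V FV]; have [m nm VE] := (FP n).1 _ FV.
  by rewrite -VE; apply; apply: miss; split=> //; rewrite VE.
have Minf : infinite_set [set n | M n !=set0].
  move=> finM; apply: Winf.
  apply: (@sub_finite_set _ _ (W @` [set n | M n !=set0] `|` [set set0])).
    move=> _ [n _ <-]; have [Mn0|Mn0] := pselect (M n !=set0).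
      by left; exists n.
    right; apply/seteqP; split=> // w Ww; apply: (Wmissed n w _ Ww) => m Mm.
    by case: Mn0; exists m.
  by rewrite finite_setU; split=> //; exact: finite_image.
have [w wP] := HM M Mn Mk Minf; apply: wP.
apply: (finite_fibres (W := W) (Wpf w)) => [n [_ miss]|n0 [[m0 Mm0] _]].
  by split; [exists n|exact: Wmissed].
have finM0 : finite_set (M n0) by apply/finite_set_leP; exists k.
have [w0 w0q] := exists_zero_set finM0.
have nW0 : ~ W n0 w0.
  apply: Wmissed => m Mm; rewrite w0q.
  by apply: missed_singleton; [left|right].
have /finite_natP[N MN] := finM0.
apply/finite_natP; exists N => n [[[m Mm] _] WE].
rewrite ltnNge; apply/negP => Nn; apply: nW0; rewrite -WE.
have [nm Fm] := Mm; exists (block_set k n m) => // -[]; rewrite w0q => -[/= m0'|/MN].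
  by rewrite m0' in nm.
lia.
Qed.

End Selection.

(** * Sparse sets defeating a given selection *)

(** The union of the blocks [M n] over a very sparse set of indices [n]:
    the gap after a block [M n] is so long that, from any [p] up to the
    last element of that block, the interval [p, b p) does not reach the next one. *)
Lemma sparse_diagonal (k : nat) (b : nat -> nat) (M : nat -> set nat) :
  (forall n m, M n m -> (n < m)%N) -> (forall n, (M n #<= `I_k)%card) ->
  infinite_set [set n | M n !=set0] ->
  exists x : set nat, [/\ ~ x 0,
    infinite_set [set n | M n !=set0 /\ forall m, M n m -> missed k n m x] &
    forall f, le_star f b -> sparse k f x].
Proof.
move=> Mn Mk Minf.
have /choice[u uP] : forall n, exists u, (n <= u)%N /\
    forall m, M n m -> (m <= u)%N.
  move=> n; have finM : finite_set (M n) by apply/finite_set_leP; exists k.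
  have /finite_natP[N MN] := finM; exists (maxn n N); rewrite leq_maxl.
  by split=> // m /MN mN; rewrite leq_max (ltnW mN) orbT.
pose B v := \max_(s < v.+1) b s.
have bB p v : (p <= v)%N -> (b p <= B v)%N.
  rewrite -ltnS => pv.
  exact: (leq_bigmax (F := fun s : 'I_v.+1 => b s) (Ordinal pv)).
have /choice[nx nxP] : forall n, exists n',
    [/\ (u n < n')%N, (B (u n) <= n')%N & M n' !=set0].
  move=> n; have [n' n'P Mn'] :=
    (infinite_natP _).1 Minf (maxn (u n).+1 (B (u n))).
  by exists n'; rewrite geq_max in n'P; case/andP: n'P.
pose N j := iter j.+1 nx 0.
have NS j : (u (N j) < N j.+1)%N by have [] := nxP (N j).
have BN j : (B (u (N j)) <= N j.+1)%N by have [] := nxP (N j).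
have MN j : M (N j) !=set0 by have [] := nxP (iter j nx 0).
have uN j : (N j <= u (N j))%N by have [] := uP (N j).
have Nmono j j' : (j <= j')%N -> (N j <= N j')%N.
  elim: j' => [|j' IH]; first by rewrite leqn0 => /eqP->.
  rewrite leq_eqVlt => /orP[/eqP->//|/IH Hj].
  by have := NS j'; have := uN j'; lia.
have jN j : (j <= N j)%N.
  by elim: j => // j IH; have := NS j; have := uN j; lia.
have MuN j m : M (N j) m -> (N j < m <= u (N j))%N.
  by move=> Mm; rewrite (Mn _ _ Mm); have [_] := uP (N j); apply.
pose x := [set m | exists j, M (N j) m].
exists x; split.
- by case=> j /Mn.
- apply/infinite_natP => L; exists (N L); first exact: jN.
  split=> // m Mm; split; first by exists L.
  right; apply: card_le_trans (Mk (N L)); apply: subset_card_le.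
  move=> i [[l Mi] nim]; have := MuN _ _ Mi; have := MuN _ _ Mm.
  have [lL|Ll|<-//] := ltngtP l L.
    by have := NS l; have := Nmono _ _ lL; lia.
  by have := NS L; have := Nmono _ _ Ll; lia.
- move=> f /le_starP[T fb]; exists T => p Tp.
  have fbp := fb p Tp.
  have [ex|no] := pselect (exists j, exists2 m, M (N j) m & (p <= m)%N); last first.
    apply: (@card_le_inj _ _ _ _ id) => // i [[j Mi] /andP[pi _]].
    by case: no; exists j, i.
  have exb : exists j, `[< exists2 m, M (N j) m & (p <= m)%N >].
    by have [j jP] := ex; exists j; apply/asboolP.
  case: (ex_minnP exb) => j /asboolP[m Mm pm] jmin.
  apply: card_le_trans (Mk (N j)); apply: subset_card_le.
  move=> i [[l Mi] pif]; have := MuN _ _ Mi; have := MuN _ _ Mm.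
  have jl : (j <= l)%N.
    by apply: jmin; apply/asboolP; exists i => //; lia.
  have [lj|jl'|<-//] := ltngtP l j; first by lia.
  move=> mu iu; have pu : (p <= u (N j))%N by lia.
  by have := bB _ _ pu; have := BN j; have := Nmono _ _ jl'; lia.
Qed.

(** * Embedding the Cantor space in the real line *)

Section Embedding.
Import Order.TTheory GRing.Theory Num.Theory.
Variable R : realType.
Local Open Scope ring_scope.
Implicit Types x y : set nat.

Definition digit_sum x (n : nat) : R :=
  \sum_(i < n) (if `[< x i >] then 3^-1 ^+ i else 0).

Definition cantor_real x : R := sup (range (digit_sum x)).

Let weight (n : nat) : R := 3^-1 ^+ n.

Lemma weight_gt0 n : 0 < weight n. Proof. by rewrite exprn_gt0 // invr_gt0. Qed.

Lemma weightS n : weight n = 3 * weight n.+1.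
Proof. by rewrite /weight exprS mulrA divff ?mul1r // pnatr_eq0. Qed.

Lemma digit_sumS x n : digit_sum x n.+1 =
  digit_sum x n + if `[< x n >] then weight n else 0.
Proof. by rewrite /digit_sum big_ord_recr. Qed.

(** All the weights from place [n] on add up to at most [3 / 2 * weight n]; the
    bound [digit_sum x n + 3 / 2 * weight n] therefore decreases with [n]. *)
Lemma digit_sum_tail x n m : digit_sum x n <= digit_sum x (n + m) /\
  digit_sum x (n + m) + 3 / 2 * weight (n + m) <= digit_sum x n + 3 / 2 * weight n.
Proof.
elim: m => [|m [IH1 IH2]]; first by rewrite addn0.
rewrite addnS digit_sumS; have := weight_gt0 (n + m).+1; have := weightS (n + m).
by case: ifP => _ ? ?; split; lra.
Qed.

Lemma cantor_real_bounds x n :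
  digit_sum x n <= cantor_real x <= digit_sum x n + 3 / 2 * weight n.
Proof.
have ub : ubound (range (digit_sum x)) (digit_sum x n + 3 / 2 * weight n).
  move=> _ [m _ <-]; have [nm|mn] := leqP n m.
    have [_] := digit_sum_tail x n (m - n); rewrite subnKC // => H.
    by have := weight_gt0 m; lra.
  have [H _] := digit_sum_tail x m (n - m); rewrite subnKC ?(ltnW mn) // in H.
  by have := weight_gt0 n; lra.
apply/andP; split.
  by apply: ub_le_sup; [exists (digit_sum x n + 3 / 2 * weight n)|exists n].
by apply: ge_sup => //; exists (digit_sum x 0); exists 0%N.
Qed.

Lemma eq_digit_sum x y n : (forall i, (i < n)%N -> (x i <-> y i)) ->
  digit_sum x n = digit_sum y n.
Proof.
by move=> xy; apply: eq_bigr => i _; rewrite (propext (xy i (ltn_ord i))).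
Qed.

Lemma cantor_real_close x (eps : R) : 0 < eps -> exists n,
  forall y, (forall i, (i < n)%N -> (x i <-> y i)) ->
    `|cantor_real x - cantor_real y| < eps.
Proof.
move=> eps0.
have [n nP] : exists n, 3 / 2 * weight n < eps.
  have z1 : `|3^-1 : R| < 1 by rewrite ger0_norm; lra.
  have /cvgrPdist_lt/(_ eps eps0)[n _ nP] := cvg_geometric (3 / 2) z1.
  exists n; apply: le_lt_trans (nP n (leqnn n)).
  by rewrite sub0r normrN ler_norm.
exists n => y xy; have := cantor_real_bounds x n; have := cantor_real_bounds y n.
rewrite (eq_digit_sum xy) ltr_norml => /andP[? ?] /andP[? ?].
by apply/andP; split; lra.
Qed.

(** At the first place where two sets differ, the weight exceeds twice the
    total weight of all later places. *)
Lemma cantor_real_apart x y n : `|cantor_real x - cantor_real y| < weight n / 2 ->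
  forall i, (i < n)%N -> (x i <-> y i).
Proof.
suff main x' y' i : (forall j, (j < i)%N -> (x' j <-> y' j)) -> x' i -> ~ y' i ->
    weight i / 2 <= cantor_real x' - cantor_real y'.
  move=> close; elim/ltn_ind => i IH iltn.
  have win : weight n <= weight i.
    have -> : n = (i + (n - i))%N by lia.
    elim: (n - i)%N => [|m IHm]; rewrite ?addn0 // addnS.
    by have := weightS (i + m); have := weight_gt0 (i + m).+1; lra.
  have agree j : (j < i)%N -> (x j <-> y j).
    by move=> ji; apply: IH => //; apply: ltn_trans iltn.
  move: close; rewrite ltr_norml => /andP[? ?].
  split=> H; apply: contrapT => nH.
    by have := main _ _ _ agree H nH; lra.
  have agree' j : (j < i)%N -> (y j <-> x j) by move=> /agree[]; split.
  by have := main _ _ _ agree' H nH; lra.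
move=> agree xi yi.
have /andP[+ _] := cantor_real_bounds x' i.+1.
have /andP[_ +] := cantor_real_bounds y' i.+1.
rewrite !digit_sumS (asboolT xi) (asboolF yi) (eq_digit_sum agree).
by have := weightS i; lra.
Qed.

Lemma cantor_real_inj : injective cantor_real.
Proof.
move=> x y xy; apply/seteqP; split=> i.
  by apply: (@cantor_real_apart x y i.+1 _ i _).1; rewrite // xy subrr normr0;
    have := weight_gt0 i.+1; lra.
by apply: (@cantor_real_apart x y i.+1 _ i _).2; rewrite // xy subrr normr0;
  have := weight_gt0 i.+1; lra.
Qed.

Lemma open_set_typeP (X : set R) (V : set (set_type X)) : open V <->
  forall v, V v -> exists2 eps : R, 0 < eps &
    forall v', `|val v - val v'| < eps -> V v'.
Proof.
split=> [[Z Zo <-] v Zv|VP].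
  have /nbhs_ballP[eps /= eps0 epsZ] := open_nbhs_nbhs (conj Zo Zv).
  by exists eps => // v' vv'; exact: epsZ.
exists (\bigcup_(v in V) \bigcup_(e in [set e : R | 0 < e /\
    forall v', `|val v - val v'| < e -> V v']) ball (val v) e).
  apply: bigcup_open => v _; apply: bigcup_open => e [e0 _]; exact: ball_open.
apply/seteqP; split=> [v' [v _ [e [_ eV] ve]]|v Vv]; first exact: eV.
have [e e0 eV] := VP v Vv.
by exists v => //; exists e => //; exact: ballxx.
Qed.

(** Real numbers are close exactly when the sets they encode agree on a long
    initial segment, so the metric topology of the image is the one inherited from the
    Cantor space, and the rest of the argument can take place among sets of naturals. *)
Lemma cantor_induced_image (P : set (set nat)) :
  exists r : set_type (cantor_real @` P) -> set nat,
    [/\ cantor_induced r, injective r, forall v, P (r v) &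
        forall x, P x -> exists v, r v = x].
Proof.
have /choice[r rP] : forall v : set_type (cantor_real @` P),
    exists x, P x /\ cantor_real x = val v.
  by move=> v; have [x Px xv] := set_valP v; exists x.
exists r; split.
- move=> V; rewrite open_set_typeP; split=> VP v Vv.
    have [e e0 eV] := VP v Vv.
    have [n nP] := cantor_real_close (r v) e0.
    by exists n => v' vv'; apply: eV; rewrite -(rP v).2 -(rP v').2; exact: nP.
  have [n nV] := VP v Vv; exists (weight n / 2); first by have := weight_gt0 n; lra.
  move=> v'; rewrite -(rP v).2 -(rP v').2 => close.
  by apply: nV; exact: cantor_real_apart close.
- by move=> v v' vv'; apply: val_inj; rewrite -(rP v).2 -(rP v').2 vv'.
- by move=> v; have [] := rP v.
- move=> x Px; have ex : (cantor_real @` P) (cantor_real x) by exists x.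
  exists (SigSub (mem_set ex)); apply: cantor_real_inj.
  by rewrite (rP _).2.
Qed.

End Embedding.

(** * A family of sparse sets indexed by the continuum *)

(** One set of naturals serves at once as a name for a function and as a name for
    a sequence of sets, so that a single index set of size the continuum runs over
    both the bounds to be respected and the selections to be defeated. *)
Definition code_fun (t : set nat) (n : nat) : nat := xget 0 [set m | t (pickle (n, m))].

Definition code_sets (t : set nat) (n : nat) : set nat := [set m | t (pickle (n, m))].

Lemma code_sets_surj (M : nat -> set nat) : exists t, code_sets t = M.
Proof.
exists [set c | exists n, exists2 m, M n m & c = pickle (n, m)].
apply/funext => n; apply/seteqP; split=> m.
  by move=> [n' [m' Mm /(pcan_inj pickleK) [-> ->]]].
by exists n, m.
Qed.

Lemma code_fun_surj (f : nat -> nat) : exists t, code_fun t = f.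
Proof.
have [t tE] := code_sets_surj (fun n => [set f n]).
exists t; apply/funext => n; rewrite /code_fun.
have -> : [set m | t (pickle (n, m))] = [set f n] by rewrite -[RHS](congr1 (@^~ n) tE).
by apply: (@xgetPex _ 0 [set f n]); exists (f n).
Qed.

(** The sequences of index sets that arise when at most [k] members are selected
    from each of the block covers and the selected unions form a point-cofinite cover. *)
Definition selection (k : nat) (M : nat -> set nat) : Prop :=
  [/\ forall n m, M n m -> (n < m)%N, forall n, (M n #<= `I_k)%card &
      infinite_set [set n | M n !=set0]].

(** The set [x t] defeats the selection named by [t] and is sparse for all functions
    named by predecessors of [t], which have a common bound by b = c. A given
    function is named by some [s], and only the sets [x t] with [t] in the initial
    segment below [s] may fail to be sparse for it. *)
Lemma sparse_family (hbc : b_eq_c) (k : nat) :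
  exists x : set nat -> set nat, [/\
    forall t, ~ x t 0,
    forall M, selection k M -> exists t, infinite_set
      [set n | M n !=set0 /\ forall m, M n m -> missed k n m (x t)] &
    forall f, exists2 B : set (set nat),
      (forall g : set nat -> nat -> nat, exists h, forall t, B t -> le_star (g t) h) &
      forall t, ~ B t -> sparse k f (x t)].
Proof.
have [L [Ltot Lsmall]] := small_segments hbc.
have /choice[x xP] : forall t, exists x : set nat, [/\ ~ x 0,
    selection k (code_sets t) -> infinite_set [set n | code_sets t n !=set0 /\
      forall m, code_sets t n m -> missed k n m x] &
    forall s, L s t -> sparse k (code_fun s) x].
  move=> t; have [sel|nsel] := pselect (selection k (code_sets t)); last first.
    by exists set0; split=> // s _; exact: finite_sparse.
  have [b bP] := Lsmall t code_fun.
  have [Mn Mk Minf] := sel; have [x [x0 xM xs]] := sparse_diagonal b Mn Mk Minf.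
  by exists x; split=> // s /bP; exact: xs.
exists x; split=> [t|M selM|f].
- by have [] := xP t.
- have [t tM] := code_sets_surj M; exists t.
  by have [_ + _] := xP t; rewrite tM; apply.
- have [s <-] := code_fun_surj f; exists [set t | L t s] => [g|t nts].
    by have [h hP] := Lsmall s g; exists h.
  by have [_ _] := xP t; apply; case: (Ltot s t).
Qed.

(** * Separating the selection properties *)

(* [set_type X] carries the subspace topology induced from R. *)
Theorem theorem10p3 (R : realType) (hbc : b_eq_c) (k : nat) (hk : (1 <= k)%N) :
  exists X : set R,
    [/\ infinite_set X,
        U_Gamma_Gamma k.+1 (set_type X) &
        ~ U_Gamma_Gamma k (set_type X)].
Proof.
have [x [x0 xM xs]] := sparse_family hbc k.
pose P : set (set nat) := [set q | finite_set q] `|` range x.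
have [r [rind rinj rP Pr]] := @cantor_induced_image R P.
have rfin q : finite_set q -> exists v, r v = q by move=> finq; apply: Pr; left.
exists (@cantor_real R @` P); split.
- apply/infiniteP.
  apply: (@card_le_inj _ _ _ _ (fun n => @cantor_real R [set n])) => [n _|n m _ _].
    by exists [set n] => //; left; exact: finite_set1.
  move/cantor_real_inj => nm.
  by have : [set n] n by []; rewrite nm.
- apply: (sparse_U_Gamma_Gamma rind rfin) => f.
  have [B Bsmall Bsparse] := xs f.
  exists [set v | exists2 t, B t & r v = x t]; split=> [g|v nBv].
    (* the family is indexed by sets of naturals, so [g] is read along [x];
       injectivity of [r] makes this well defined *)
    have /choice[g' g'P] : forall t, exists g' : nat -> nat,
        forall v, r v = x t -> g v = g'.
      move=> t; have [[v vt]|no] := pselect (exists v, r v = x t).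
        by exists (g v) => v' v't; congr g; apply: rinj; rewrite v't.
      by exists id => v vt; case: no; exists v.
    have [h hP] := Bsmall g'; exists h => v [t Bt vt].
    by rewrite (g'P t v vt); exact: hP.
  have [fin|[t _ tv]] := rP v; first exact: finite_sparse.
  by rewrite -tv; apply: Bsparse => Bt; apply: nBv; exists t.
- apply: (not_U_Gamma_Gamma rind rfin) => [v|M Mn Mk Minf].
    by have [fin|[t _ <-]] := rP v; [left|right; exact: x0].
  have [t tM] := xM M (And3 Mn Mk Minf).
  have [v vt] : exists v, r v = x t by apply: Pr; right; exists t.
  by exists v; rewrite vt.
Qed.
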